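(* For $I,J\in\mathcal I$ with $I\vartriangleleft J$, the unique $\vartriangleleft$-minimal set in $\mathcal M(I)$ and the unique $\vartriangleleft$-minimal set in $\mathcal M(J)$ are identical.
   Context: Let $(a_i)_{i=1,\dots,n}$ be a sequence of distinct integers between $1$ and $n$, and set $a_0=0$; write $A=(a_i)_{i=0,1,\dots,n}$. A set $I\subseteq\{0\}\cup[n]$ is feasible if $a_i<a_j$ for all $i,j\in I$ with $i<j$; $\mathcal I$ denotes the family of feasible sets of maximum cardinality. Patience sorting: start with empty piles $P_0,\dots,P_n$; for $i=0,1,\dots,n$ in order, put $a_i$ on top of the pile $P_j$ with smallest index $j$ such that $P_j$ is empty or the top element of $P_j$ is greater than $a_i$. Let $P_0,\dots,P_k$ be the resulting nonempty piles. Say $a_u$ is placed below $a_v$ on a pile if both lie on the same pile and $a_u$ was put there before $a_v$. For $I,J\in\mathcal I$, write $I\vartriangleleft J$ if $I\setminus J=\{u\}$ and $J\setminus I=\{v\}$ for some $u,v$ such that $a_u$ is placed strictly below $a_v$ on pile $P_i$ for some $1\le i\le k$. For $I\in\mathcal I$, $\mathcal M(I)\subseteq\mathcal I$ is the smallest family containing $I$ such that whenever $J\in\mathcal M(I)$ and $J'\vartriangleleft J$ then $J'\in\mathcal M(I)$. A set $I\in\mathcal I$ is $\vartriangleleft$-minimal if there is no $J\in\mathcal I$ with $J\vartriangleleft I$. (Each $\mathcal M(I)$ contains exactly one $\vartriangleleft$-minimal set.) *)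

(* Defs.v *)
From mathcomp Require Import all_boot.
Unset Printing Implicit Defensive.

(* World: plain MathComp.
   The sequence is given by a : nat -> nat (only a 1, ..., a n matter);
   indices 0..n are the ordinals 'I_n.+1, and A i := a_i with a_0 = 0. *)

Section Patience.
Variables (n : nat) (a : nat -> nat).

Definition A (i : nat) : nat := if i is 0 then 0 else a i.

Definition feasible (I : {set 'I_n.+1}) : Prop :=
  forall i j : 'I_n.+1, i \in I -> j \in I -> (i < j)%N -> (A i < A j)%N.

Definition maxfeas (I : {set 'I_n.+1}) : Prop :=
  feasible I /\ forall J : {set 'I_n.+1}, feasible J -> (#|J| <= #|I|)%N.

(* Patience sorting. Piles are lists of indices, top of pile first.
   Index i is put on the first pile whose top element is greater than a_i,
   or on a new (empty) pile at the end if there is none. *)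
Fixpoint place (i : nat) (piles : seq (seq nat)) : seq (seq nat) :=
  match piles with
  | [::] => [:: [:: i]]
  | p :: ps =>
      if (match p with [::] => true | t :: _ => (A i < A t)%N end)
      then (i :: p) :: ps
      else p :: place i ps
  end.

Definition piles : seq (seq nat) := foldl (fun ps i => place i ps) [::] (iota 0 n.+1).

(* a_u is placed strictly below a_v on pile P_j for some 1 <= j <= k.
   Element a_i is put on its pile at step i, so "a_u was put there before a_v"
   means u < v. *)
Definition below (u v : 'I_n.+1) : Prop :=
  exists j : nat, [/\ (1 <= j)%N, (j < size piles)%N,
    (nat_of_ord u \in nth [::] piles j), (nat_of_ord v \in nth [::] piles j) & (u < v)%N].

Definition lhd (I J : {set 'I_n.+1}) : Prop :=
  maxfeas I /\ maxfeas J /\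
  exists u v : 'I_n.+1, [/\ I :\: J = [set u], J :\: I = [set v] & below u v].

Definition inM (I K : {set 'I_n.+1}) : Prop :=
  forall F : {set {set 'I_n.+1}},
    I \in F -> (forall J J', J \in F -> lhd J' J -> J' \in F) -> K \in F.

Definition lhd_minimal (I : {set 'I_n.+1}) : Prop :=
  maxfeas I /\ ~ (exists J, lhd J I).

End Patience.

(* Main.v *)
Require Import Defs.
Set Warnings "-notation-overridden".
From mathcomp Require Import all_boot zify boolp.
From Stdlib Require Import Relations_3 Relations_3_facts.

(* A step I <| J trades an element v of J for an element u < v, so the sum of the
   indices drops and <| is terminating.  It is also locally confluent.  Two steps
   removing the same x insert elements u < w of the pile of x, and u lies below w
   on that pile, so one is a further step below the other.  Two steps
   J - x + u and J - y + w with x < y commute: the piles give a_x < a_u and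
   a_y < a_w, feasibility of the two steps then forces u < x < w and a_u < a_w,
   so J - x - y + u + w is again maximum feasible.  By Newman's lemma J has a
   single <|-minimal set below it, and both minimal sets lie below J as I <| J. *)

Set Implicit Arguments.
Unset Strict Implicit.

Section NormalForms.
Variables (U : Type) (R : Relation U).

Lemma Rstar_from_normal x y : (forall z, ~ R x z) -> Rstar U R x y -> y = x.
Proof. by move=> nx [|z w /nx]. Qed.

Lemma Confluent_normal_forms_eq x y z : Confluent U R ->
  Rstar U R x y -> Rstar U R x z -> (forall w, ~ R y w) -> (forall w, ~ R z w) ->
  y = z.
Proof.
move=> conf xy xz ny nz; have [w [yw zw]] := conf x y z xy xz.
by rewrite -(Rstar_from_normal ny yw) (Rstar_from_normal nz zw).
Qed.

End NormalForms.

Lemma setD1U1 (T : finType) (B : {set T}) u y : u != y -> (u |: B) :\ y = u |: B :\ y.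
Proof.
by move=> uy; apply/setP=> z; rewrite !inE; case: eqP => // ->; rewrite eq_sym (negbTE uy).
Qed.

Lemma setD_exchange (T : finType) (J : {set T}) u v : u \notin J -> v \in J ->
  (u |: J :\ v) :\: J = [set u] /\ J :\: (u |: J :\ v) = [set v].
Proof.
move=> uJ vJ; have vu : v != u by apply: contraTneq vJ => ->.
split; apply/setP=> z; rewrite !inE.
- have [->|_] := eqVneq z u; first by rewrite (negbTE uJ).
  by case: (z \in J); rewrite ?andbF.
- have [->|zv] := eqVneq z v; first by rewrite (negbTE vu) vJ.
  have [->|_] := eqVneq z u; first by rewrite (negbTE uJ).
  by case: (z \in J).
Qed.

Lemma exchange_of_setD (T : finType) (I J : {set T}) u v :
  I :\: J = [set u] -> J :\: I = [set v] -> [/\ u \notin J, v \in J & I = u |: J :\ v].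
Proof.
move=> /setP IJ /setP JI.
have := IJ u; have := JI v; rewrite !inE !eqxx => /andP[vI vJ] /andP[uJ uI].
split=> //; apply/setP=> z; rewrite !inE.
have := IJ z; have := JI z; rewrite !inE.
by case: (z \in I); case: (z \in J) => /= <- <-; rewrite ?orbF.
Qed.

Lemma uniq_flatten_mem_nth (T : eqType) (s : seq (seq T)) x j1 j2 :
  uniq (flatten s) -> j1 < size s -> j2 < size s ->
  x \in nth [::] s j1 -> x \in nth [::] s j2 -> j1 = j2.
Proof.
have mem_flatten (t : seq (seq T)) j : j < size t -> x \in nth [::] t j -> x \in flatten t.
  by move=> jt xj; apply/flattenP; exists (nth [::] t j); rewrite ?mem_nth.
elim: s j1 j2 => [|p s IH] [|j1] [|j2] //=; rewrite cat_uniq => /and3P[_ disj us] j1s j2s x1 x2.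
- by case/hasP: disj; exists x; rewrite // (mem_flatten _ j2).
- by case/hasP: disj; exists x; rewrite // (mem_flatten _ j1).
- by congr S; apply: IH x1 x2.
Qed.

Section PatienceSorting.
Variables (n : nat) (a : nat -> nat).

(* Piles are listed top first: [pile_rel] relates an entry to the one just below it. *)
Definition pile_rel : rel nat := fun x y => (y < x) && (A a x < A a y).

Lemma pile_rel_trans : transitive pile_rel.
Proof. by move=> y x z /andP[yx Axy] /andP[zy Ayz]; apply/andP; split; lia. Qed.

Lemma sorted_pile_A p x y :
  sorted pile_rel p -> x \in p -> y \in p -> x < y -> A a y < A a x.
Proof.
move=> sp xp yp xy; have lt_index := sorted_ltn_index pile_rel_trans sp.
case: (ltngtP (index x p) (index y p)).
- by move/(lt_index _ _ xp yp)/andP=> [yx _]; lia.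
- by move/(lt_index _ _ yp xp)/andP=> [].
- by move/(congr1 (nth 0 p)); rewrite !nth_index // => exy; rewrite exy ltnn in xy.
Qed.

Lemma place_perm i ps : perm_eq (flatten (place a i ps)) (i :: flatten ps).
Proof.
elim: ps => [|p ps IH] //=; case: ifP => _ //=.
apply: (@perm_trans _ (p ++ i :: flatten ps)); first by rewrite perm_cat2l.
by rewrite (perm_catCA p [:: i]).
Qed.

Lemma place_sorted i ps : all (sorted pile_rel) ps ->
  (forall x, x \in flatten ps -> x < i) -> all (sorted pile_rel) (place a i ps).
Proof.
elim: ps => [|p ps IH] //= /andP[sp sps] lti.
case: ifP => top /=.
- rewrite sps andbT; case: p sp top lti => [|t q] //= sp top lti.
  by rewrite sp andbT /pile_rel top lti // inE eqxx.
- by rewrite sp IH // => x xps; apply: lti; rewrite mem_cat xps orbT.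
Qed.

Definition piles_upto m := foldl (fun ps i => place a i ps) [::] (iota 0 m).

Lemma piles_upto_inv m :
  perm_eq (flatten (piles_upto m)) (iota 0 m) /\ all (sorted pile_rel) (piles_upto m).
Proof.
elim: m => [|m [perm_m sorted_m]] //.
rewrite /piles_upto -addn1 iotaD foldl_cat /= -/(piles_upto m); split.
- apply: perm_trans (place_perm _ _) _.
  by rewrite add0n perm_sym perm_catC /= perm_cons perm_sym.
- by apply: place_sorted => // x; rewrite (perm_mem perm_m) mem_iota.
Qed.

Local Notation T := 'I_n.+1.

Lemma below_A (u v : T) : below n a u v -> A a v < A a u.
Proof.
case=> j [_ js uj vj uv]; have [_ /allP sorted_piles] := piles_upto_inv n.+1.
by apply: sorted_pile_A uj vj uv; apply: sorted_piles; rewrite mem_nth.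
Qed.

Lemma below_same_top (u w x : T) :
  below n a u x -> below n a w x -> u < w -> below n a u w.
Proof.
case=> j1 [j1_ge1 j1s u1 x1 _] [j2 [_ j2s w2 x2 _]] uw.
have [perm_piles _] := piles_upto_inv n.+1.
have uniq_piles : uniq (flatten (piles n a)) by rewrite (perm_uniq perm_piles) iota_uniq.
by rewrite (uniq_flatten_mem_nth uniq_piles j1s j2s x1 x2) in j1_ge1 u1 *; exists j2.
Qed.

Lemma feasible_subset (I J : {set T}) : I \subset J -> feasible n a J -> feasible n a I.
Proof. by move=> /subsetP IJ fJ i j /IJ iJ /IJ jJ; apply: fJ. Qed.

Lemma feasible_setU1U1 (S : {set T}) u w : feasible n a (u |: S) -> feasible n a (w |: S) ->
  u < w -> A a u < A a w -> feasible n a (u |: (w |: S)).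
Proof.
move=> fu fw uw Auw i j; rewrite !inE.
move=> /or3P[/eqP->|/eqP->|iS] /or3P[/eqP->|/eqP->|jS] ij; try lia.
all: first [by apply: fu; rewrite ?inE ?eqxx ?iS ?jS ?orbT
           | by apply: fw; rewrite ?inE ?eqxx ?iS ?jS ?orbT].
Qed.

Lemma maxfeas_exchange (J : {set T}) u v : maxfeas n a J -> u \notin J -> v \in J ->
  feasible n a (u |: J :\ v) -> maxfeas n a (u |: J :\ v).
Proof.
move=> [_ maxJ] uJ vJ fI; split=> // K /maxJ /leq_trans; apply.
by rewrite cardsU1 !inE (negbTE uJ) andbF (cardsD1 v J) vJ.
Qed.

Lemma lhdP (I J : {set T}) : lhd n a I J <->
  [/\ maxfeas n a I, maxfeas n a J &
      exists u v, [/\ u \notin J, v \in J, I = u |: J :\ v & below n a u v]].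
Proof.
split=> [[mI [mJ [u [v [IJ JI uv]]]]] | [mI mJ [u [v [uJ vJ eqI uv]]]]].
- by have [uJ vJ eqI] := exchange_of_setD IJ JI; split=> //; exists u, v.
- have [IJ JI] := setD_exchange uJ vJ.
  by split=> //; split=> //; exists u, v; rewrite eqI.
Qed.

Definition weight (J : {set T}) := \sum_(i in J) (i : nat).

Lemma lhd_weight (I J : {set T}) : lhd n a I J -> weight I < weight J.
Proof.
case/lhdP=> _ _ [u [v [uJ vJ -> [_ [_ _ _ _ uv]]]]].
rewrite /weight big_setU1 /= ?inE ?(negbTE uJ) ?andbF // (big_setD1 v vJ) /=.
by rewrite ltn_add2r.
Qed.

(* Oriented as a rewriting step of [Relations_3]: from [J] down to any [I <| J]. *)
Definition lhd_step : Relation {set T} := fun J I => lhd n a I J.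

Lemma lhd_noetherian : Noetherian _ lhd_step.
Proof.
suff noeth m J : weight J < m -> noetherian _ lhd_step J.
  by move=> J; apply: (noeth (weight J).+1).
elim: m J => [|m IH] J; first by rewrite ltn0.
by move=> ltJ; constructor=> I /lhd_weight IJ; apply: IH; apply: leq_trans IJ _.
Qed.

Lemma lhd_same_top (J : {set T}) u w x : u \notin J -> w \notin J ->
  maxfeas n a (u |: J :\ x) -> maxfeas n a (w |: J :\ x) ->
  below n a u x -> below n a w x -> u < w -> lhd n a (u |: J :\ x) (w |: J :\ x).
Proof.
move=> uJ wJ mu mw ux wx ltuw; apply/lhdP; split=> //; exists u, w; split.
- by rewrite !inE negb_or -val_eqE /= ltn_eqF // (negbTE uJ) andbF.
- by rewrite setU11.
- by rewrite setU1K // !inE (negbTE wJ) andbF.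
- exact: below_same_top ux wx ltuw.
Qed.

Lemma lhd_diamond (J : {set T}) u w x y : u \notin J -> w \notin J ->
  x \in J -> y \in J -> x < y ->
  maxfeas n a (u |: J :\ x) -> maxfeas n a (w |: J :\ y) ->
  below n a u x -> below n a w y ->
  exists L, lhd n a L (u |: J :\ x) /\ lhd n a L (w |: J :\ y).
Proof.
move=> uJ wJ xJ yJ xy mu mw ux wy; have [[fu _] [fw _]] := (mu, mw).
have [[_ [_ _ _ _ ltux]] [_ [_ _ _ _ ltwy]]] := (ux, wy).
have [Axu Ayw] := (below_A ux, below_A wy).
have neq z t : z \notin J -> t \in J -> z != t by move=> zJ tJ; apply: contraNneq zJ => ->.
have yx : y != x by rewrite -val_eqE /= gtn_eqF.
have yJ1 : y \in u |: J :\ x by rewrite !inE yJ yx orbT.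
have xJ2 : x \in w |: J :\ y by rewrite !inE xJ (eq_sym x y) yx orbT.
have Auw : A a u < A a w.
  have := fu u y; rewrite setU11 yJ1 => /(_ isT isT (ltn_trans ltux xy)); lia.
have ltxw : x < w.
  case: (ltngtP x w) => // [wx|/val_inj exw]; last by rewrite -exw xJ in wJ.
  have := fw w x; rewrite setU11 xJ2 => /(_ isT isT wx); lia.
have ltuw := ltn_trans ltux ltxw.
have wJ1 : w \notin u |: J :\ x by rewrite !inE negb_or (negbTE wJ) andbF -val_eqE /= gtn_eqF.
have uJ2 : u \notin w |: J :\ y by rewrite !inE negb_or (negbTE uJ) andbF -val_eqE /= ltn_eqF.
have eqL : w |: (u |: J :\ x) :\ y = u |: (w |: J :\ y) :\ x.
  by rewrite !setD1U1 ?neq // setUCA !setDDl (setUC [set x]).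
have fL : feasible n a (w |: (u |: J :\ x) :\ y).
  rewrite setD1U1 ?neq // setUCA; apply: feasible_setU1U1 => //.
  - by apply: feasible_subset fu; apply/setUS/subsetDl.
  - by apply: feasible_subset fw; apply: setUS; rewrite setDDl setUC -setDDl subsetDl.
have mL := maxfeas_exchange mu wJ1 yJ1 fL.
exists (w |: (u |: J :\ x) :\ y); split; apply/lhdP; split=> //.
- by exists w, y.
- by exists u, x; rewrite eqL.
Qed.

Lemma lhd_locally_confluent : Locally_confluent _ lhd_step.
Proof.
move=> J J1 J2 /lhdP[m1 _ [u [x [uJ xJ eq1 ux]]]] /lhdP[m2 _ [w [y [wJ yJ eq2 wy]]]].
subst J1 J2; case: (ltngtP x y) => [xy|yx|/val_inj exy].
- have [L [L1 L2]] := lhd_diamond uJ wJ xJ yJ xy m1 m2 ux wy.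
  by exists L; split; apply: Rstar_contains_R.
- have [L [L2 L1]] := lhd_diamond wJ uJ yJ xJ yx m2 m1 wy ux.
  by exists L; split; apply: Rstar_contains_R.
- subst y; case: (ltngtP u w) => [uw|wu|/val_inj euw].
  + exists (u |: J :\ x); split; first exact: Rstar_0.
    exact/Rstar_contains_R/(lhd_same_top uJ wJ m1 m2 ux wy uw).
  + exists (w |: J :\ x); split; last exact: Rstar_0.
    exact/Rstar_contains_R/(lhd_same_top wJ uJ m2 m1 wy ux wu).
  + by subst w; exists (u |: J :\ x); split; apply: Rstar_0.
Qed.

Lemma inM_Rstar I K : inM n a I K -> Rstar _ lhd_step I K.
Proof.
move=> IK; suff: K \in [set L | `[< Rstar _ lhd_step I L >]] by rewrite inE => /asboolP.
apply: IK => [|L L']; rewrite !inE; first exact/asboolP/Rstar_0.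
move=> /asboolP IL L'L; apply/asboolP.
exact: Rstar_transitive _ _ _ _ _ IL (Rstar_contains_R _ _ L L' L'L).
Qed.

End PatienceSorting.

Theorem corollary2 (n : nat) (a : nat -> nat)
  (ha_range : forall i, (1 <= i <= n)%N -> (1 <= a i <= n)%N)
  (ha_inj : forall i j, (1 <= i <= n)%N -> (1 <= j <= n)%N -> a i = a j -> i = j)
  (I J : {set 'I_n.+1}) :
  lhd n a I J ->
  forall K K' : {set 'I_n.+1},
    inM n a I K -> lhd_minimal n a K ->
    inM n a J K' -> lhd_minimal n a K' ->
    K = K'.
Proof.
(* The argument never uses that [a] permutes [1..n]. *)
move=> IJ K K' /inM_Rstar IK [_ minK] /inM_Rstar JK' [_ minK'].
have JK : Rstar _ (@lhd_step n a) J K := Rstar_n _ _ J I K IJ IK.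
have confluent := Newman _ _ (@lhd_noetherian n a) (@lhd_locally_confluent n a).
apply: (Confluent_normal_forms_eq confluent JK JK').
- by move=> L KL; apply: minK; exists L.
- by move=> L K'L; apply: minK'; exists L.
Qed.
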